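(* Let $\mathfrak{M}$ be a von Neumann algebra, let $A\in\mathfrak{M}$ be a nonzero positive element, and let $P$ be the orthogonal projection onto the range of $A$. If $A$ is well-supported, then $\sigma_A^l(T)=\sigma^l(PT,P\mathfrak{M}P)$ and $\sigma_A^r(T)=\sigma^r(PT,P\mathfrak{M}P)$ for any $T\in\mathfrak{M}^A$. In particular $\sigma_A(T)=\sigma(PT,P\mathfrak{M}P)$.
   Context: $\mathfrak{M}$ acts on a complex Hilbert space $\mathcal{H}$ and contains the identity $I$. The positive element $A$ is called well-supported if $\sigma(A)\setminus\{0\}$ is closed, equivalently $\sigma(A)\subseteq\{0\}\cup[\alpha,\infty)$ for some $\alpha>0$; in this case the range of $A$ is closed. The projection $P$ belongs to $\mathfrak{M}$. For $h\in\mathcal{H}$ put $\|h\|_A=\sqrt{\langle Ah,h\rangle}$, for $T\in\mathfrak{M}$ put $\|T\|_A=\sup\{\|Th\|_A:\|h\|_A=1\}$, and set $\mathfrak{M}^A=\{T\in\mathfrak{M}:\|T\|_A<\infty\}$. For $T\in\mathfrak{M}^A$ one has $PT=PTP\in P\mathfrak{M}P$. $T\in\mathfrak{M}^A$ is left (resp. right) $A$-invertible in $\mathfrak{M}^A$ if there is $S\in\mathfrak{M}^A$ with $AST=A$ (resp. $ATS=A$), and $A$-invertible in $\mathfrak{M}^A$ if there is $S\in\mathfrak{M}^A$ with $ATS=AST=A$. The sets $\sigma_A^l(T)$, $\sigma_A^r(T)$, $\sigma_A(T)$ consist of the $\lambda\in\mathbb{C}$ such that $\lambda I-T$ is not left $A$-invertible,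 not right $A$-invertible, not $A$-invertible in $\mathfrak{M}^A$, respectively. For $X\in P\mathfrak{M}P$, the sets $\sigma^l(X,P\mathfrak{M}P)$, $\sigma^r(X,P\mathfrak{M}P)$, $\sigma(X,P\mathfrak{M}P)$ are the left spectrum, right spectrum and spectrum of $X$ in the algebra $P\mathfrak{M}P$ with unit $P$ (the $\lambda$ such that $\lambda P-X$ is not left invertible, not right invertible, not invertible in $P\mathfrak{M}P$). *)

(* Defs.v *)
From HB Require Import structures.
From mathcomp Require Import all_boot all_order all_algebra.
From mathcomp Require Import sesquilinear.
From mathcomp Require Import complex.
From mathcomp Require Import all_classical all_reals all_analysis.

Set Implicit Arguments.
Unset Strict Implicit.
Unset Printing Implicit Defensive.

Import Order.TTheory GRing.Theory Num.Theory.
Import numFieldNormedType.Exports.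

Local Open Scope classical_set_scope.
Local Open Scope complex_scope.
Local Open Scope ring_scope.

(* A complex Hilbert space is a Banach space [H] over [R[i]] together with a
   positive definite hermitian form [dot], linear in its first argument, which
   induces the norm of [H]. *)
Definition hilbert_dot (R : realType) (H : completeNormedModType R[i])
    (dot : {dot H for Num.conj}) : Prop :=
  forall x : H, `|x| ^+ 2 = dot x x.

Section Operators.
Context (R : realType) (H : completeNormedModType R[i]).
Context (dot : {dot H for Num.conj}).
Implicit Types (S T X A P e : H -> H) (M N : set (H -> H)).

Definition bounded_op : set (H -> H) := [set T | linear T /\ continuous T].

Definition adjoint T S : Prop := forall x y, dot (T x) y = dot x (S y).

Definition wot_closure M : set (H -> H) :=
  [set T | bounded_op T /\
    forall (s : seq (H * H)) (eps : R[i]), 0 < eps ->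
      exists2 S, M S &
        forall xy, xy \in s -> `|dot (T xy.1 - S xy.1) xy.2| < eps].

Record von_neumann_algebra M : Prop := {
  vna_bounded : M `<=` bounded_op ;
  vna_id : M idfun ;
  vna_add : forall S T, M S -> M T -> M (S \+ T) ;
  vna_scale : forall (a : R[i]) T, M T -> M (a \*: T) ;
  vna_comp : forall S T, M S -> M T -> M (S \o T) ;
  vna_adjoint : forall S T, M T -> bounded_op S -> adjoint T S -> M S ;
  vna_closed : wot_closure M `<=` M }.

Definition positive_op A : Prop := forall h, 0 <= dot (A h) h.

(* Spectra in an algebra [N] of operators whose unit is the operator [e], not
   necessarily the identity of [H]. *)
Definition left_invertible N e X : Prop := exists2 S, N S & S \o X = e.
Definition right_invertible N e X : Prop := exists2 S, N S & X \o S = e.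
Definition invertible N e X : Prop :=
  exists2 S, N S & S \o X = e /\ X \o S = e.

Definition left_spectrum N e X : set R[i] :=
  [set l | ~ left_invertible N e (l \*: e \- X)].
Definition right_spectrum N e X : set R[i] :=
  [set l | ~ right_invertible N e (l \*: e \- X)].
Definition spectrum N e X : set R[i] :=
  [set l | ~ invertible N e (l \*: e \- X)].

Definition well_supported M A : Prop :=
  @closed (R[i] : numFieldType) (spectrum M idfun A `\ 0).

(* The closure makes sense of the projection onto the range of an arbitrary
   [A]; it is redundant when the range is closed. *)
Definition range_projection A P : Prop :=
  forall h, closure (range A) (P h) /\
    forall v, closure (range A) v -> dot (h - P h) v = 0.

Definition corner P M : set (H -> H) := [set P \o T \o P | T in M].

Definition seminormA A (h : H) : R := Num.sqrt (complex.Re (dot (A h) h)).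

Definition opnormA A T : \bar R :=
  ereal_sup [set (seminormA A (T h))%:E | h in [set h | seminormA A h = 1]].

Definition A_bounded M A : set (H -> H) :=
  [set T | M T /\ (opnormA A T < +oo)%E].

Definition left_A_invertible M A T : Prop :=
  exists2 S, A_bounded M A S & A \o S \o T = A.
Definition right_A_invertible M A T : Prop :=
  exists2 S, A_bounded M A S & A \o T \o S = A.
Definition A_invertible M A T : Prop :=
  exists2 S, A_bounded M A S & A \o T \o S = A /\ A \o S \o T = A.

Definition left_A_spectrum M A T : set R[i] :=
  [set l | ~ left_A_invertible M A (l \*: idfun \- T)].
Definition right_A_spectrum M A T : set R[i] :=
  [set l | ~ right_A_invertible M A (l \*: idfun \- T)].
Definition A_spectrum M A T : set R[i] :=
  [set l | ~ A_invertible M A (l \*: idfun \- T)].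

End Operators.

(* Main.v *)
Require Import Defs.
From HB Require Import structures.
From mathcomp Require Import all_boot all_order all_algebra.
From mathcomp Require Import sesquilinear.
From mathcomp Require Import complex.
From mathcomp Require Import all_classical all_reals all_analysis.
From mathcomp Require Import ring lra.

Set Implicit Arguments.
Unset Strict Implicit.
Unset Printing Implicit Defensive.

Import Order.TTheory GRing.Theory Num.Theory.
Import numFieldNormedType.Exports.

Local Open Scope classical_set_scope.
Local Open Scope complex_scope.
Local Open Scope ring_scope.

(** The whole theorem rests on two facts: the range projection [P] belongs to
    [M], and [A >= b P] as forms for some [b > 0].

    Granted these, put [X = l - T] and [Y = l P - P T]. Boundedness for the
    seminorm of [A] forces [T], and any [A]-bounded [S], to preserve the kernel of
    [A], so that [P T P = P T] and [P S P = P S]. As [A] and [P] have the same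
    kernel, [A S X = A] amounts to [P S X = P], that is to [(P S P) Y = P];
    similarly for [A X S = A]. So [S |-> P S P] turns [A]-inverses into inverses
    in the corner. Conversely an inverse in the corner is already an
    [A]-inverse: it lies in [M] because [P] does, and it is [A]-bounded because it
    factors through [P] and the seminorm of [A] dominates [sqrt b |P h|].

    Both facts come from the gap in the spectrum near [0], without any
    functional calculus. If [A - s] is invertible for [0 < s < b], then
    [A ^ 2 >= b A] ([spectral_gap], [spectral_gap_form]): centering the gap
    reduces this to a symmetric [D] with [D - s] bounded below for [|s| < r], and
    there the greatest lower bound of [D ^ 2] cannot be less than [r ^ 2].
    Cauchy-Schwarz for the form of [A] and density of the range upgrade
    [A ^ 2 >= b A] to [A >= b P] ([range_projection_coercive]). Finally
    [A >= b P] makes [A (A + eps)^-1] converge to [P] in norm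
    ([right_resolvent_approx]); since these operators lie in [M] for small [eps],
    so does [P] ([vna_range_projection]). *)

(** * Linear maps and real quadratics *)

Section LinearMaps.
Context (R : realType) (H : completeNormedModType R[i]) (T : H -> H).
Hypothesis linT : linear T.

Lemma linear_fun0 : T 0 = 0.
Proof. by have := linT (-1) 0 0; rewrite scaler0 addr0 scaleN1r addNr. Qed.

Lemma linear_funD x y : T (x + y) = T x + T y.
Proof. by have := linT 1 x y; rewrite !scale1r. Qed.

Lemma linear_funZ a x : T (a *: x) = a *: T x.
Proof. by have := linT a x 0; rewrite linear_fun0 !addr0. Qed.

Lemma linear_funB x y : T (x - y) = T x - T y.
Proof. by rewrite linear_funD -scaleN1r linear_funZ scaleN1r. Qed.

Lemma linear_funN x : T (- x) = - T x.
Proof. by rewrite -scaleN1r linear_funZ scaleN1r. Qed.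

End LinearMaps.

(** The common source of the Cauchy-Schwarz inequalities below. *)
Lemma discriminant_le (R : realFieldType) (a b c : R) : 0 <= c ->
  (forall t : R, 0 <= a + 2 * t * b + t ^+ 2 * c) -> b ^+ 2 <= a * c.
Proof.
move=> c0 h.
have [c_eq0|cn0] := eqVneq c 0.
  have [->|bn0] := eqVneq b 0; first by rewrite c_eq0 mulr0 expr0n.
  have := h (- (a + 1) / (2 * b)).
  rewrite c_eq0 mulr0 addr0 (_ : 2 * _ * b = - (a + 1)); last by field.
  lra.
have cp : 0 < c by rewrite lt_def cn0.
have := h (- b / c).
have -> : a + 2 * (- b / c) * b + (- b / c) ^+ 2 * c = (a * c - b ^+ 2) / c.
  by field.
by rewrite pmulr_lge0 ?invr_gt0// subr_ge0.
Qed.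

(** * The real inner product of a complex Hilbert space *)

Section HilbertSpace.
Context (R : realType) (H : completeNormedModType R[i]).
Context (dot : {dot H for Num.conj}) (dotH : hilbert_dot dot).
Implicit Types (x y z : H) (t k r s b eps : R) (A P Q S T : H -> H).

Lemma dotDl x y z : dot (x + y) z = dot x z + dot y z.
Proof. exact: linearDl. Qed.

Lemma dotBl x y z : dot (x - y) z = dot x z - dot y z.
Proof. exact: linearBl. Qed.

Lemma dotZl a x y : dot (a *: x) y = a * dot x y.
Proof. by rewrite linearZl_LR. Qed.

Lemma dotC x y : dot x y = (dot y x)^*%C.
Proof. by rewrite hermC /= mul1r. Qed.

(** The real part of the form is a real inner product. It takes values in a
    totally ordered field, so estimates can be run in [R] rather than in [R[i]]. *)
Definition re x y : R := complex.Re (dot x y).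

Lemma reC x y : re x y = re y x.
Proof. by rewrite /re dotC; case: (dot y x). Qed.

Lemma reDl x y z : re (x + y) z = re x z + re y z.
Proof. by rewrite /re dotDl raddfD. Qed.

Lemma reNl x y : re (- x) y = - re x y.
Proof. by rewrite /re linearNl raddfN. Qed.

Lemma reZl t x y : re (t%:C *: x) y = t * re x y.
Proof. by rewrite /re dotZl; case: (dot x y) => a b /=; rewrite mul0r subr0. Qed.

Lemma reDr x y z : re z (x + y) = re z x + re z y.
Proof. by rewrite reC reDl !(reC z). Qed.

Lemma reNr x y : re y (- x) = - re y x.
Proof. by rewrite reC reNl (reC y). Qed.

Lemma reZr t x y : re y (t%:C *: x) = t * re y x.
Proof. by rewrite reC reZl (reC y). Qed.

Definition reE := (reDl, reDr, reNl, reNr, reZl, reZr).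

Definition sqn x := re x x.

Lemma dot_sqn x : dot x x = (sqn x)%:C.
Proof. by rewrite /sqn /re RRe_real// ger0_real. Qed.

Lemma sqn_ge0 x : 0 <= sqn x.
Proof. by rewrite -ler0c -dot_sqn dnorm_ge0. Qed.

Lemma sqn_eq0 x : sqn x = 0 -> x = 0.
Proof. by move=> x0; apply/eqP; rewrite -(dnorm_eq0 dot) dot_sqn x0. Qed.

Lemma normr_sqn x : `|x| ^+ 2 = (sqn x)%:C.
Proof. by rewrite dotH dot_sqn. Qed.

Lemma sqnZ t x : sqn (t%:C *: x) = t ^+ 2 * sqn x.
Proof. by rewrite /sqn !reE mulrA. Qed.

Definition re_symmetric Q := forall x y, re (Q x) y = re x (Q y).
Definition re_positive Q := forall x, 0 <= re (Q x) x.
Definition sq_bounded k T := forall x, sqn (T x) <= k ^+ 2 * sqn x.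
Definition bounded_below T := exists2 c : R, 0 < c &
  forall x, c * sqn x <= sqn (T x).

(** A positive symmetric operator [Q] defines the semi-inner product
    [re (Q x) y], whose Cauchy-Schwarz inequality is used in place of the square
    root of [Q]. *)
Lemma form_cauchy_schwarz Q x y : linear Q -> re_symmetric Q ->
  re_positive Q -> re (Q x) y ^+ 2 <= re (Q x) x * re (Q y) y.
Proof.
move=> linQ symQ posQ; apply: discriminant_le => // t.
have := posQ (x + t%:C *: y).
rewrite linear_funD// linear_funZ// !reE (_ : re (Q y) x = re (Q x) y).
  lra.
by rewrite symQ reC.
Qed.

Lemma re_cauchy_schwarz x y : re x y ^+ 2 <= sqn x * sqn y.
Proof. exact: (@form_cauchy_schwarz id _ _ _ _ sqn_ge0). Qed.

Lemma sqnD_le x y : sqn (x + y) <= 2 * sqn x + 2 * sqn y.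
Proof. by have := sqn_ge0 (x - y); rewrite /sqn !reE (reC y x); lra. Qed.

(** Multiplying [x] by the conjugate of [dot x y] makes the product real, which
    reduces the complex inequality to the real one. *)
Lemma dot_cauchy_schwarz x y : `|dot x y| ^+ 2 <= (sqn x * sqn y)%:C.
Proof.
set d := dot x y; rewrite -add_Re2_Im2 lecR.
set n := _ + _ .
have n0 : 0 <= n by rewrite addr_ge0// sqr_ge0.
have rn : re ((d^*)%C *: x) y = n.
  by rewrite /re dotZl -/d /n; case: (d) => a b /=; ring.
have sn : sqn ((d^*)%C *: x) = n * sqn x.
  apply: complexI; rewrite -dot_sqn (dnormZ dot) dot_sqn normcJ -add_Re2_Im2.
  by rewrite -rmorphM.
have := re_cauchy_schwarz ((d^*)%C *: x) y; rewrite rn sn.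
have [->|nn0] := eqVneq n 0; first by rewrite mulr_ge0 ?sqn_ge0.
by rewrite expr2 -mulrA ler_pM2l// lt_def nn0.
Qed.

Lemma bounded_op_sq_bounded T :
  bounded_op T -> exists2 k : R, 0 < k & sq_bounded k T.
Proof.
move=> [linT contT].
pose f : {linear H -> H} := HB.pack T (GRing.isLinear.Build _ _ _ _ T linT).
have /linear_boundedP : bounded_near f (nbhs (0 : H)).
  by apply: continuous_linear_bounded; exact: contT.
move=> /pinfty_ex_gt0 [r r0 Tr].
have rR : r = (complex.Re r)%:C by rewrite RRe_real// gtr0_real.
exists (complex.Re r); first by rewrite -ltcR -rR.
move=> x; rewrite -lecR rmorphM rmorphXn /= -rR -!normr_sqn -exprMn.
by rewrite ler_pXn2r ?nnegrE// ?mulr_ge0// ?(ltW r0)//; exact: Tr.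
Qed.

Lemma sq_bounded_bounded_op T : linear T -> sq_bounded 1 T -> bounded_op T.
Proof.
move=> linT bT; split=> //.
pose f : {linear H -> H} := HB.pack T (GRing.isLinear.Build _ _ _ _ T linT).
apply: (@bounded_linear_continuous _ _ _ f); apply/linear_boundedP.
near=> r => x.
have r1 : 1 <= r by near: r; exact: nbhs_pinfty_ge.
apply: (@le_trans _ _ `|x|); last by rewrite ler_peMl.
rewrite -(@ler_pXn2r _ 2)// ?nnegrE// !normr_sqn lecR.
by have := bT x; rewrite expr1n mul1r.
Unshelve. all: by end_near. Qed.


Lemma sq_bounded_of_le (C : R) T : 0 <= C ->
  (forall x, sqn (T x) <= C * sqn x) -> exists2 k : R, 0 < k & sq_bounded k T.
Proof.
move=> C0 CT; exists (1 + C); first by rewrite ltr_pwDl.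
move=> x; apply: (le_trans (CT x)); rewrite ler_wpM2r ?sqn_ge0//.
by rewrite sqrrD expr1n mul1r mulr2n; have := sqr_ge0 C; lra.
Qed.

Lemma re_le_sq_bounded k T x : 0 < k -> sq_bounded k T ->
  re (T x) x <= k * sqn x.
Proof.
move=> k0 bT.
have [r0|r0] := leP 0 (re (T x) x); last first.
  by apply: (le_trans (ltW r0)); rewrite mulr_ge0 ?sqn_ge0 ?ltW.
rewrite -(@ler_pXn2r _ 2)// ?nnegrE//; last first.
  by rewrite mulr_ge0 ?sqn_ge0 ?ltW.
apply: (le_trans (re_cauchy_schwarz _ _)).
by rewrite exprMn (expr2 (sqn x)) mulrA ler_wpM2r ?sqn_ge0.
Qed.

(** The inequality [Q ^ 2 <= k Q] for [0 <= Q <= k], obtained from the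
    semi-inner product of [Q] applied to [x] and [Q x]. *)
Lemma sqn_le_form k Q x : 0 < k -> sq_bounded k Q -> linear Q ->
  re_symmetric Q -> re_positive Q -> sqn (Q x) <= k * re (Q x) x.
Proof.
move=> k0 bQ linQ symQ posQ.
have [->|n0] := eqVneq (sqn (Q x)) 0; first by rewrite mulr_ge0// ltW.
have := form_cauchy_schwarz x (Q x) linQ symQ posQ.
have := re_le_sq_bounded (Q x) k0 bQ.
rewrite -[re (Q x) (Q x)]/(sqn (Q x)) => h1 h2.
have sp : 0 < sqn (Q x) by rewrite lt_def n0 sqn_ge0.
rewrite -(ler_pM2r sp) -expr2; apply: (le_trans h2).
by rewrite (mulrC k) -mulrA ler_wpM2l.
Qed.

(** For positive operators, being bounded below in norm is as strong as being
    bounded below as a form. *)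
Lemma bounded_below_coercive k Q : 0 < k -> sq_bounded k Q -> linear Q ->
  re_symmetric Q -> re_positive Q -> bounded_below Q ->
  exists2 c : R, 0 < c & forall x, c * sqn x <= re (Q x) x.
Proof.
move=> k0 bQ linQ symQ posQ [c c0 cQ].
exists (c / k); first by rewrite divr_gt0.
move=> x; rewrite mulrAC ler_pdivrMr// mulrC (mulrC _ k).
by rewrite mulrC (le_trans (cQ x))// sqn_le_form.
Qed.

Lemma sq_bounded_shift k s T : sq_bounded k T ->
  exists2 k' : R, 0 < k' & sq_bounded k' (fun x => T x - s%:C *: x).
Proof.
move=> bT; have C0 : 0 <= 2 * (k ^+ 2 + s ^+ 2).
  by rewrite mulr_ge0// addr_ge0// sqr_ge0.
apply: (sq_bounded_of_le C0) => x.
have := sqnD_le (T x) ((- s)%:C *: x).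
rewrite sqnZ rmorphN scaleNr => /le_trans; apply.
by rewrite sqrrN -mulrDr -mulrA ler_pM2l// mulrDl lerD2r.
Qed.

Lemma linear_shift s T : linear T -> linear (fun x => T x - s%:C *: x).
Proof.
move=> linT a x y; rewrite linT scalerBr scalerDr !scalerA opprD.
by rewrite (mulrC a) addrACA.
Qed.

Lemma re_symmetric_shift s T :
  re_symmetric T -> re_symmetric (fun x => T x - s%:C *: x).
Proof. by move=> symT x y; rewrite !reE symT. Qed.

(** * Gaps in the spectrum of a symmetric operator *)

(** If the spectrum of the symmetric operator [D] avoids the interval from [- r]
    to [r], then [D ^ 2 >= r ^ 2]. Let [s ^ 2] be the greatest lower bound of the
    form of [D ^ 2]. If [s < r], the positive operator
    [D ^ 2 - s ^ 2 = (D + s) (D - s)] is a product of two operators bounded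
    below, hence it is coercive, and [s ^ 2] could be increased. *)
Lemma spectral_gap k D r : 0 < k -> sq_bounded k D -> linear D ->
  re_symmetric D -> 0 < r ->
  (forall s, - r < s < r -> bounded_below (fun x => D x - s%:C *: x)) ->
  forall x, r ^+ 2 * sqn x <= sqn (D x).
Proof.
move=> k0 bD linD symD r0 gap x0; apply/negPn/negP; rewrite -ltNge => x0r.
have sx0 : 0 < sqn x0.
  rewrite lt_def sqn_ge0 andbT; apply/eqP => s0.
  by move: x0r; rewrite s0 mulr0 ltNge sqn_ge0.
(* The lower bounds of the form of [D ^ 2]; they are bounded by the failure at
   [x0]. *)
pose E := [set m : R | 0 <= m /\ forall x, m * sqn x <= sqn (D x)].
have E0 : E 0 by split=> // x; rewrite mul0r sqn_ge0.
have Er : ubound E (r ^+ 2).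
  move=> m [_ /(_ x0) mx0].
  by rewrite -(ler_pM2r sx0); apply: (le_trans mx0); exact: ltW.
have supE : has_sup E by split; [exists 0|exists (r ^+ 2)].
have mu0 : 0 <= sup E by apply: ub_le_sup => //; case: supE.
have muD x : sup E * sqn x <= sqn (D x).
  have [->|n0] := eqVneq (sqn x) 0; first by rewrite mulr0 sqn_ge0.
  have sp : 0 < sqn x by rewrite lt_def n0 sqn_ge0.
  rewrite -ler_pdivlMr//; apply: ge_sup; first by exists 0.
  by move=> m [_ mD]; rewrite ler_pdivlMr.
have mur : sup E < r ^+ 2.
  by rewrite -(ltr_pM2r sx0); apply: le_lt_trans (muD x0) x0r.
pose s := Num.sqrt (sup E).
have s2 : s ^+ 2 = sup E by rewrite sqr_sqrtr.
have s0 : 0 <= s by exact: sqrtr_ge0.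
have sr : s < r by rewrite -(@ltr_pXn2r _ 2)// ?nnegrE ?s2// ltW.
pose Q x := D (D x) - (s ^+ 2)%:C *: x.
have linQ : linear Q by apply: linear_shift => a x y; rewrite !linD.
have symQ : re_symmetric Q by apply: re_symmetric_shift => x y; rewrite !symD.
have reQ x : re (Q x) x = sqn (D x) - s ^+ 2 * sqn x.
  by rewrite /Q !reE symD.
have posQ : re_positive Q by move=> x; rewrite reQ s2 subr_ge0.
have [kQ kQ0 bQ] : exists2 kQ, 0 < kQ & sq_bounded kQ Q.
  apply: (@sq_bounded_shift (k * k)) => x.
  by rewrite exprMn -mulrA (le_trans (bD _))// ler_wpM2l ?sqr_ge0.
have blQ : bounded_below Q.
  have [c c0 cD] : bounded_below (fun x => D x - s%:C *: x).
    by apply: gap; rewrite sr andbT; lra.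
  have [d d0 dD] : bounded_below (fun x => D x - (- s)%:C *: x).
    by apply: gap; lra.
  exists (d * c); first exact: mulr_gt0.
  move=> x; rewrite -mulrA.
  apply: (le_trans (ler_wpM2l (ltW d0) (cD x))).
  apply: (le_trans (dD _)).
  rewrite linear_funB// linear_funZ// rmorphN scaleNr opprK scalerBr scalerA.
  by rewrite -rmorphM -expr2 addrA subrK.
have [c c0 cQ] := bounded_below_coercive kQ0 bQ linQ symQ posQ blQ.
have : E (sup E + c).
  split=> [|x]; first by rewrite addr_ge0// ltW.
  by have := cQ x; rewrite reQ s2 mulrDl; lra.
by move=> /(ub_le_sup (proj2 supE)); lra.
Qed.

(** Centering the gap from [0] to [b] at [b / 2], the inequality
    [(A - b / 2) ^ 2 >= (b / 2) ^ 2] expands to [A ^ 2 >= b A]. *)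
Lemma spectral_gap_form k b A : 0 < b -> sq_bounded k A -> linear A ->
  re_symmetric A ->
  (forall s, 0 < s < b -> bounded_below (fun x => A x - s%:C *: x)) ->
  forall x, b * re (A x) x <= sqn (A x).
Proof.
move=> b0 bA linA symA gap x.
pose m := b / 2; pose D y := A y - m%:C *: y.
have [kD kD0 bD] : exists2 k' : R, 0 < k' & sq_bounded k' D.
  exact: sq_bounded_shift bA.
have linD : linear D by exact: linear_shift.
have symD : re_symmetric D by exact: re_symmetric_shift.
have m0 : 0 < m by rewrite divr_gt0.
have := spectral_gap kD0 bD linD symD m0 _ x.
rewrite {2}/D /sqn !reE (reC x) => h.
suff : m ^+ 2 * re x x <=
    re (A x) (A x) - m * re (A x) x - (m * re (A x) x - m * (m * re x x)).
  by rewrite {2 3}/m expr2; lra.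
have {h} := h _; rewrite !opprD !opprK => h.
apply: (le_trans (h _)) => [s /andP[s1 s2]|]; last by lra.
have [|c c0 cA] := gap (m + s); first by rewrite /m in s1 s2 *; lra.
exists c => // y; rewrite /D -addrA -opprD -scalerDl -rmorphD; exact: cA.
Qed.

(** Polarization: the sesquilinear form [dot (A x) y - dot x (A y)] vanishes on
    the diagonal because [dot (A x) x] is real, hence it vanishes. *)
Lemma positive_self_adjoint A : linear A -> positive_op dot A ->
  adjoint dot A A.
Proof.
move=> linA posA x y.
pose F u v := dot (A u) v - dot u (A v).
have FDl u v w : F (u + v) w = F u w + F v w.
  by rewrite /F linear_funD// !dotDl; ring.
have FDr u v w : F w (u + v) = F w u + F w v.
  by rewrite /F linear_funD// !linearDr /=; ring.
have FZl a u v : F (a *: u) v = a * F u v.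
  by rewrite /F linear_funZ// !dotZl; ring.
have FZr a u v : F v (a *: u) = (a^*)%C * F v u.
  by rewrite /F linear_funZ// !linearZr_LR /=; ring.
have Fxx u : F u u = 0.
  rewrite /F (dotC u); have := posA u.
  case: (dot (A u) u) => p q; rewrite lecE /= => /andP[/eqP -> _].
  by rewrite oppr0 subrr.
have h1 : F x y + F y x = 0.
  by have := Fxx (x + y); rewrite FDl !FDr !Fxx addr0 add0r.
have h2 : F x y - F y x = 0.
  have := Fxx ('i%C *: x + y); rewrite FDl !FDr !FZl !FZr !Fxx => h3.
  apply: (@mulfI _ 'i%C); first by rewrite eq_complex /= oner_eq0 andbF.
  rewrite mulr0 -h3; set f := F x y; set g := F y x.
  have -> : ('i^*)%C = - 'i%C :> R[i] by rewrite /= /GRing.opp /= oppr0.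
  by ring.
have h3 : 2 * F x y = 0 by have := congr2 +%R h1 h2; rewrite addr0 => <-; ring.
by move/eqP: h3; rewrite mulf_eq0 pnatr_eq0 /= subr_eq0 => /eqP.
Qed.

Lemma adjoint_re_symmetric A : adjoint dot A A -> re_symmetric A.
Proof. by move=> adjA x y; rewrite /re adjA. Qed.

Lemma positive_op_re A : positive_op dot A -> re_positive A.
Proof. by move=> posA x; have := posA x; rewrite lecE => /andP[]. Qed.

(** * The projection onto the closure of the range *)

Section RangeProjection.
Context (A P : H -> H).
Hypotheses (linA : linear A) (adjA : adjoint dot A A).
Hypothesis projP : range_projection dot A P.

Lemma range_projection_unique h u : closure (range A) u ->
  (forall v, closure (range A) v -> dot (h - u) v = 0) -> P h = u.
Proof.
move=> ru hu; have [rPh hPh] := projP h.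
suff d0 v : closure (range A) v -> dot (P h - u) v = 0.
  apply/eqP; rewrite -subr_eq0 -(dnorm_eq0 dot).
  by rewrite linearBr /= !d0// subr0.
move=> rv; rewrite -[P h - u](_ : (h - u) - (h - P h) = _); last first.
  by rewrite opprB [h - u]addrC addrACA subrr addr0 addrC.
by rewrite dotBl hu// hPh// subr0.
Qed.

Lemma range_projection_id h : P (A h) = A h.
Proof.
apply: range_projection_unique => [|v _]; last by rewrite subrr linear0l.
by apply: subset_closure; exists h.
Qed.

Lemma range_projection_idem h : P (P h) = P h.
Proof.
apply: range_projection_unique => [|v _]; last by rewrite subrr linear0l.
by have [] := projP h.
Qed.

(** The kernel of a self-adjoint operator is orthogonal to its range. *)
Lemma range_projection_cancel h : A (P h) = A h.
Proof.
apply/eqP; rewrite eq_sym -subr_eq0 -linear_funB// -(dnorm_eq0 dot) adjA.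
apply/eqP; have [_] := projP h; apply.
by apply: subset_closure; exists (A (h - P h)).
Qed.

Lemma linear_range_projection : linear P.
Proof.
move=> a x y.
have d0 v : closure (range A) v -> dot (P (a *: x + y) - (a *: P x + P y)) v = 0.
  move=> rv; have [_ hx] := projP x; have [_ hy] := projP y.
  have [_ hxy] := projP (a *: x + y).
  have /eqP := hx v rv; rewrite dotBl subr_eq0 => /eqP hxv.
  have /eqP := hy v rv; rewrite dotBl subr_eq0 => /eqP hyv.
  have /eqP := hxy v rv; rewrite dotBl subr_eq0 => /eqP.
  by rewrite !(dotBl, dotDl, dotZl) hxv hyv => ->; rewrite subrr.
apply/eqP; rewrite -subr_eq0 -(dnorm_eq0 dot).
have rP u : closure (range A) (P u) by have [] := projP u.
rewrite linearBr /= linearDr /= linearZr_LR /= !(d0 _ (rP _)).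
by rewrite mulr0 addr0 subr0.
Qed.

Lemma re_range_projection h u : closure (range A) u -> re u h = re u (P h).
Proof.
move=> ru; have [_ /(_ u ru)] := projP h.
move=> h0; apply/eqP; rewrite -subr_eq0 -reNr -reDr reC /re.
by rewrite h0.
Qed.

Lemma sqn_range_projection h : sqn (P h) = re (P h) h.
Proof. by rewrite (@re_range_projection h (P h))//; have [] := projP h. Qed.

Lemma sq_bounded_range_projection : sq_bounded 1 P.
Proof.
move=> h; rewrite expr1n mul1r.
have := sqn_ge0 (h - P h); rewrite {1}/sqn !reE (reC h) -sqn_range_projection.
by rewrite -/(sqn h) -/(sqn (P h)); lra.
Qed.

Lemma range_dense h eps : 0 < eps -> exists z, sqn (P h - A z) < eps.
Proof.
move=> eps0; have [/(_ (ball (P h) (Num.sqrt eps)%:C)) + _] := projP h.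
have s0 : 0 < (Num.sqrt eps)%:C by rewrite ltcR sqrtr_gt0.
move=> /(_ (nbhsx_ballx _ _ s0)) [_ [[z _ <-]]].
rewrite -ball_normE /= => hz; exists z.
rewrite -ltcR -normr_sqn -(sqr_sqrtr (ltW eps0)) rmorphXn.
by rewrite ltr_pXn2r ?nnegrE// ltW.
Qed.

(** The gap makes [A >= b P]. For [u = A z], the Cauchy-Schwarz inequality of the
    form of [A] and the gap give [b (re u h) ^ 2 <= re (A h) h * sqn u], and
    [re u h = re u (P h)]; letting [u] tend to [P h] yields the claim. The
    limit is replaced by a single [z], close enough to contradict the strict
    opposite inequality. *)
Lemma range_projection_coercive b : 0 < b -> re_positive A ->
  (forall x, b * re (A x) x <= sqn (A x)) ->
  forall h, b * sqn (P h) <= re (A h) h.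
Proof.
move=> b0 posA gapA h; apply/negPn/negP; rewrite -ltNge => hlt.
set p := sqn (P h) in hlt; set q := re (A h) h in hlt.
have q0 : 0 <= q by exact: posA.
have p0 : 0 < p by rewrite -(pmulr_rgt0 _ b0); apply: le_lt_trans hlt.
(* The tolerance keeps [p - d] halfway between [q / b] and [p]. *)
pose d := (p - q / b) / 2.
have qbp : q / b < p by rewrite ltr_pdivrMr// mulrC.
have qb0 : 0 <= q / b by rewrite divr_ge0// ltW.
have d0 : 0 < d by rewrite divr_gt0// subr_gt0.
have [z] := range_dense h d0.
have rz : closure (range A) (A z) by apply: subset_closure; exists z.
have := form_cauchy_schwarz z h linA (adjoint_re_symmetric adjA) posA.
rewrite (re_range_projection h rz) -/q.
have := gapA z; set n := sqn (A z); set f := re (A z) z.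
rewrite /sqn !reE (reC (P h)) -/(sqn (P h)) -/(sqn (A z)) -/p -/n.
set g := re (A z) (P h) => gap1 cs dense.
have n0 : 0 <= n by exact: sqn_ge0.
have dp : d < p by rewrite /d; lra.
have bg : b * g ^+ 2 <= n * q.
  apply: (@le_trans _ _ (b * (f * q))); first by rewrite ler_pM2l.
  by rewrite mulrA ler_wpM2r.
have g0 : (n + p - d) / 2 < g by lra.
have g2 : n * (p - d) < g ^+ 2.
  apply: (@le_lt_trans _ _ (((n + p - d) / 2) ^+ 2)).
    by have := sqr_ge0 (n - (p - d)); lra.
  by rewrite ltr_pXn2r ?nnegrE//; lra.
have [n_eq0|n_neq0] := eqVneq n 0.
  move: bg g2; rewrite n_eq0 !mul0r pmulr_rle0// => /le_lt_trans lt0 /lt0.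
  by rewrite ltxx.
have : b * (n * (p - d)) < n * q.
  by apply: lt_le_trans bg; rewrite ltr_pM2l.
have n_gt0 : 0 < n by rewrite lt_def n_neq0.
rewrite mulrCA ltr_pM2l// mulrC -ltr_pdivlMr// /d; lra.
Qed.

End RangeProjection.

(** * Consequences of well-supportedness in a von Neumann algebra *)

(** If [N] is a right inverse of [A + eps], then [A N] approximates [P] in norm
    up to [eps / b]. Indeed [P x - A N x = eps P N x], and [A >= b P] bounds
    [P N x] by [b^-1 x] independently of [eps]. *)
Lemma right_resolvent_approx A P (N : H -> H) b eps x : linear A ->
  adjoint dot A A -> range_projection dot A P -> 0 < b ->
  (forall h, b * sqn (P h) <= re (A h) h) -> 0 < eps ->
  eps%:C *: N x + A (N x) = x ->
  sqn (P x - A (N x)) <= (eps / b) ^+ 2 * sqn x.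
Proof.
move=> linA adjA projP b0 coerc e0 resN.
have linP := linear_range_projection projP.
have PxE : P x = eps%:C *: P (N x) + A (N x).
  by rewrite -{1}resN linP (range_projection_id projP).
set p := sqn (P (N x)).
have p0 : 0 <= p by exact: sqn_ge0.
have bp : b * p <= re (P x) (P (N x)).
  apply: (le_trans (coerc _)); rewrite PxE !reE -/(sqn _) -/p.
  rewrite (@re_range_projection _ _ projP (N x)) ?ler_wpDl ?mulr_ge0// ?ltW//.
  by apply: subset_closure; exists (N x).
have bbp : b ^+ 2 * p <= sqn x.
  have [->|n0] := eqVneq p 0; first by rewrite mulr0 sqn_ge0.
  have pp : 0 < p by rewrite lt_def n0.
  have := sq_bounded_range_projection projP x.
  rewrite expr1n mul1r; apply: le_trans.
  rewrite -(ler_pM2r pp); apply: le_trans (re_cauchy_schwarz _ _).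
  rewrite -mulrA -expr2 -exprMn ler_pXn2r ?nnegrE//.
    by rewrite mulr_ge0// ltW.
  by apply: le_trans bp; rewrite mulr_ge0// ltW.
rewrite {1}PxE addrK sqnZ -/p expr_div_n -[leRHS]mulrA ler_pM2l ?exprn_gt0//.
by rewrite mulrC ler_pdivlMr ?exprn_gt0// mulrC.
Qed.

Section VonNeumannAlgebra.
Context (M : set (H -> H)) (vnM : von_neumann_algebra dot M).

Lemma vna_linear S : M S -> linear S.
Proof. by move=> /(vna_bounded vnM) []. Qed.

Lemma vna_sq_bounded S : M S -> exists2 k : R, 0 < k & sq_bounded k S.
Proof. by move=> /(vna_bounded vnM); exact: bounded_op_sq_bounded. Qed.

(** Since [0] lies outside the closed set of nonzero spectral values, a whole
    punctured neighbourhood of [0] consists of regular values. *)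
Lemma well_supported_resolvent A : well_supported M A ->
  exists2 b : R, 0 < b & forall s, s != 0 -> `|s| < b ->
    exists2 N, M N & forall x,
      N (s%:C *: x - A x) = x /\ s%:C *: N x - A (N x) = x.
Proof.
move=> /closed_openC oC.
have : nbhs (0 : (R[i] : numFieldType)) (~` (spectrum M idfun A `\ 0)).
  by apply: open_nbhs_nbhs; split=> // -[_]; apply.
move=> /nbhs_ballP [e /= e0 ballC].
have eR : e = (complex.Re e)%:C by rewrite RRe_real// gtr0_real.
exists (complex.Re e); first by rewrite -ltcR -eR.
move=> s s0 se.
have /ballC : ball (0 : (R[i] : numFieldType)) e s%:C.
  rewrite -ball_normE /= sub0r normrN normc_def /= expr0n addr0 sqrtr_sqr.
  by rewrite eR ltcR.
have [[N MN [NA AN]] _|ninv] := pselect (invertible M idfun (s%:C \*: idfun \- A)).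
  exists N => // x; split; first exact: (congr1 (@^~ x) NA).
  exact: (congr1 (@^~ x) AN).
by case; split=> //= /complexI s0'; rewrite s0' eqxx in s0.
Qed.

Lemma left_inverse_bounded_below (N T : H -> H) : M N ->
  (forall x, N (T x) = x) -> bounded_below T.
Proof.
move=> /vna_sq_bounded [k k0 bN] NT; exists (k ^- 2).
  by rewrite invr_gt0 exprn_gt0.
move=> x; rewrite mulrC ler_pdivrMr ?exprn_gt0// mulrC.
by rewrite -{1}(NT x); exact: bN.
Qed.

Lemma well_supported_coercive A P : M A -> positive_op dot A ->
  range_projection dot A P -> well_supported M A ->
  exists2 b : R, 0 < b & forall h, b * sqn (P h) <= re (A h) h.
Proof.
move=> MA posA projP /well_supported_resolvent [b b0 resA].
have linA := vna_linear MA; have adjA := positive_self_adjoint linA posA.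
have [k k0 bA] := vna_sq_bounded MA.
exists b => //; apply: range_projection_coercive => //.
  exact: positive_op_re.
apply: (spectral_gap_form b0 bA) => //; first exact: adjoint_re_symmetric.
move=> s /andP[s0 sb].
have [|N MN resN] := resA s (lt0r_neq0 s0); first by rewrite gtr0_norm.
have [c c0 cN] : bounded_below (fun x => s%:C *: x - A x).
  by apply: (left_inverse_bounded_below MN) => x; have [] := resN x.
exists c => // x; rewrite -opprB /sqn !(reNl, reNr) opprK; exact: cN.
Qed.

(** By the resolvent estimate, [P] is a norm limit of the elements
    [A (A + eps)^-1] of [M], so a fortiori it belongs to the weak closure. *)
Lemma vna_range_projection A P : M A -> positive_op dot A ->
  range_projection dot A P -> well_supported M A -> M P.
Proof.
move=> MA posA projP wsA.
have [b b0 coerc] := well_supported_coercive MA posA projP wsA.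
have [b' b'0 resA] := well_supported_resolvent wsA.
have linA := vna_linear MA; have adjA := positive_self_adjoint linA posA.
apply: (vna_closed vnM); split.
  apply: sq_bounded_bounded_op; first exact: linear_range_projection projP.
  exact: sq_bounded_range_projection projP.
move=> s e0 e0_gt0.
have [e e_gt0 ->] : exists2 e : R, 0 < e & e0 = e%:C.
  have e0R : e0 = (complex.Re e0)%:C by rewrite RRe_real// gtr0_real.
  by exists (complex.Re e0) => //; rewrite -ltcR -e0R.
have [C C0 sC] : exists2 C : R, 0 <= C &
    forall xy, xy \in s -> sqn xy.1 * sqn xy.2 <= C.
  elim: s => [|[x y] s [C C0 sC]]; first by exists 0.
  exists (C + sqn x * sqn y); first by rewrite addr_ge0// mulr_ge0 ?sqn_ge0.
  move=> xy; rewrite inE => /predU1P[->|/sC]; first by rewrite lerDr.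
  by move=> /le_trans; apply; rewrite lerDl mulr_ge0 ?sqn_ge0.
(* [t] bounds [eps / b] and satisfies [t ^ 2 * C < e ^ 2]. *)
pose t := e / (1 + C).
have t0 : 0 < t by rewrite divr_gt0// ltr_pwDl.
have tC : t ^+ 2 * C < e ^+ 2.
  rewrite expr_div_n mulrAC ltr_pdivrMr ?exprn_gt0 ?ltr_pwDl//.
  by rewrite ltr_pM2l ?exprn_gt0//; have := sqr_ge0 C; lra.
pose eps := Num.min (b' / 2) (b * t).
have eps0 : 0 < eps by rewrite lt_min divr_gt0// mulr_gt0.
have [||N MN resN] := resA (- eps).
- by rewrite oppr_eq0 gt_eqF.
- rewrite normrN gtr0_norm// gt_min; apply/orP; left; lra.
(* [N] inverts [- eps - A], hence [- N] inverts [A + eps]. *)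
exists (A \o (-1 \*: N)).
  by apply: (vna_comp vnM) => //; exact: (vna_scale vnM).
move=> [x y] /sC /= xyC.
rewrite -(@ltr_pXn2r _ 2)// ?nnegrE// ?ler0c ?(ltW e_gt0)//.
apply: (le_lt_trans (dot_cauchy_schwarz _ _)).
rewrite -rmorphXn ltcR; apply: le_lt_trans tC.
apply: (@le_trans _ _ ((eps / b) ^+ 2 * (sqn x * sqn y))).
  rewrite mulrA ler_wpM2r ?sqn_ge0//.
  apply: (@right_resolvent_approx A P (-1 \*: N)) => //=.
  have [_] := resN x; rewrite rmorphN scaleN1r scaleNr scalerN => resx.
  by rewrite -[RHS]resx (linear_funN linA).
apply: ler_pM; rewrite ?sqr_ge0 ?mulr_ge0 ?sqn_ge0//.
rewrite ler_pXn2r ?nnegrE ?(ltW t0)//; first last.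
  by rewrite divr_ge0// ltW.
by rewrite ler_pdivrMr// mulrC ge_min lexx orbT.
Qed.

End VonNeumannAlgebra.

(** * Operators bounded for the seminorm of [A] *)

Section ABounded.
Context (A : H -> H).
Hypotheses (linA : linear A) (posA : positive_op dot A).

Lemma opnormA_finite (C : R) T :
  (forall h, re (A (T h)) (T h) <= C * re (A h) h) -> (opnormA dot A T < +oo)%E.
Proof.
move=> TC; apply: (@le_lt_trans _ _ (Num.sqrt C)%:E); last exact: ltry.
apply: ge_ereal_sup => _ [h /= h1 <-]; rewrite lee_fin /seminormA ler_wsqrtr//.
apply: (le_trans (TC h)).
suff -> : re (A h) h = 1 by rewrite mulr1.
by rewrite -[LHS]sqr_sqrtr ?(positive_op_re posA)//
  -[Num.sqrt _]/(seminormA dot A h) h1 expr1n.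
Qed.

Lemma opnormA_bound T : (opnormA dot A T < +oo)%E ->
  exists C : R, forall h, re (A h) h = 1 -> re (A (T h)) (T h) <= C.
Proof.
move=> Tfin; exists (fine (opnormA dot A T) ^+ 2) => h h1.
have : ((seminormA dot A (T h))%:E <= opnormA dot A T)%E.
  apply: ereal_sup_ubound; exists h => //=.
  by rewrite /seminormA -[complex.Re _]/(re (A h) h) h1 sqrtr1.
case: (opnormA dot A T) Tfin => [r| |] //= _; rewrite lee_fin => Tr.
rewrite -[leLHS]sqr_sqrtr ?(positive_op_re posA)//.
by rewrite ler_pXn2r ?nnegrE ?sqrtr_ge0// (le_trans _ Tr)// sqrtr_ge0.
Qed.

Lemma positive_form_ker k x : 0 < k -> sq_bounded k A ->
  re (A x) x = 0 -> A x = 0.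
Proof.
move=> k0 bA q0; have adjA := positive_self_adjoint linA posA.
apply: sqn_eq0; apply/le_anti; rewrite sqn_ge0 andbT.
have := sqn_le_form x k0 bA linA (adjoint_re_symmetric adjA).
by rewrite q0 mulr0; apply; exact: positive_op_re.
Qed.

(** Fix [y] of seminorm one. Adding multiples of [x] in the kernel of [A] to [y]
    does not change the seminorm, so [T y + t T x] stays bounded in seminorm for
    all real [t], which forces [T x] to have seminorm zero. *)
Lemma A_bounded_ker k T x : 0 < k -> sq_bounded k A -> A <> (fun=> 0) ->
  linear T -> (opnormA dot A T < +oo)%E -> A x = 0 -> A (T x) = 0.
Proof.
move=> k0 bA A0 linT /opnormA_bound [C TC] Ax0.
have adjA := positive_self_adjoint linA posA.
have symA := adjoint_re_symmetric adjA.
have qA := positive_op_re posA.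
have [y y1] : exists y, re (A y) y = 1.
  have [[y yn0]|/forallNP q0] := pselect (exists y, re (A y) y <> 0).
    have yp : 0 < re (A y) y by rewrite lt_def qA andbT; exact/eqP.
    exists ((Num.sqrt (re (A y) y))^-1%:C *: y).
    rewrite linear_funZ// !reE mulrA -expr2 exprVn sqr_sqrtr ?(ltW yp)//.
    by rewrite mulVf// gt_eqF.
  exfalso; apply: A0; apply/funext => y.
  exact: (positive_form_ker k0 bA (contrapT (q0 y))).
have q1 t : re (A (y + t%:C *: x)) (y + t%:C *: x) = 1.
  rewrite linear_funD// linear_funZ// Ax0 scaler0 addr0 symA.
  by rewrite linear_funD// linear_funZ// Ax0 scaler0 addr0 -symA.
apply: (positive_form_ker k0 bA); apply/eqP/negPn/negP => n0.
have qp : 0 < re (A (T x)) (T x) by rewrite lt_def n0 qA.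
have C0 : 0 <= C by apply: le_trans (TC _ y1).
(* The parallelogram law bounds [t ^ 2 * re (A (T x)) (T x)] by [C]; this [t]
   makes it [C + 1]. *)
pose t := Num.sqrt ((C + 1) / re (A (T x)) (T x)).
have t2 : t * t * re (A (T x)) (T x) = C + 1.
  rewrite -expr2 sqr_sqrtr; first by rewrite divfK.
  by rewrite divr_ge0// ?(ltW qp)// addr_ge0.
have := TC _ (q1 t); have := TC _ (q1 (- t)); have := qA (T y).
move: t2; rewrite !(linear_funD linT) !(linear_funZ linT) !(linear_funD linA).
rewrite !(linear_funZ linA) !reE; lra.
Qed.

End ABounded.

End HilbertSpace.

(** * Reduction of [A]-invertibility to the corner *)

Section ReductionToCorner.
Context (R : realType) (H : completeNormedModType R[i]).
Context (dot : {dot H for Num.conj}) (dotH : hilbert_dot dot).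
Context (M : set (H -> H)) (vnM : von_neumann_algebra dot M).
Context (A : H -> H) (MA : M A) (A_neq0 : A <> (fun=> 0)).
Context (A_ge0 : positive_op dot A).
Context (P : H -> H) (projP : range_projection dot A P).
Context (A_ws : well_supported M A).

Let linA := vna_linear vnM MA.
Let adjA := positive_self_adjoint linA A_ge0.
Let linP := linear_range_projection projP.
Let AP := range_projection_cancel linA adjA projP.
Let PP := range_projection_idem projP.

Lemma ker_range_projection v : A v = 0 -> P v = 0.
Proof.
move=> Av0.
have [b b0 /(_ v)] := well_supported_coercive dotH vnM MA A_ge0 projP A_ws.
rewrite Av0 /re linear0l /= pmulr_rle0// => h.
by apply: (@sqn_eq0 _ _ dot); apply/le_anti; rewrite h sqn_ge0.
Qed.

(** [A] and [P] have the same kernel, so equations premultiplied by [A] are the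
    same as equations premultiplied by [P]. *)
Lemma range_projection_eq u v : A u = A v <-> P u = P v.
Proof.
split=> [e|e]; last by rewrite -AP e AP.
apply/eqP; rewrite -subr_eq0 -linear_funB//; apply/eqP.
by apply: ker_range_projection; rewrite linear_funB// e subrr.
Qed.

(** [h - P h] lies in the kernel of [A], which [T] preserves. *)
Lemma A_bounded_range_projection T x : A_bounded dot M A T ->
  P (T (P x)) = P (T x).
Proof.
move=> [MT Tfin]; have linT := vna_linear vnM MT.
apply/esym/eqP; rewrite -subr_eq0 -!linear_funB//; apply/eqP.
have [k k0 bA] := vna_sq_bounded dotH vnM MA.
apply/ker_range_projection/(A_bounded_ker linA A_ge0 k0 bA A_neq0) => //.
by rewrite linear_funB// AP subrr.
Qed.

(** An element of the corner factors through [P], and [A >= b P] says that the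
    seminorm of [h] controls the norm of [P h]. *)
Lemma corner_A_bounded X : corner P M X -> A_bounded dot M A X.
Proof.
move=> [Y MY <-].
have MP := vna_range_projection dotH vnM MA A_ge0 projP A_ws.
have MPY := vna_comp vnM MP MY.
split; first exact: (vna_comp vnM).
have [b b0 coerc] := well_supported_coercive dotH vnM MA A_ge0 projP A_ws.
have [k k0 bA] := vna_sq_bounded dotH vnM MA.
have [l l0 bPY] := vna_sq_bounded dotH vnM MPY.
apply: (@opnormA_finite _ _ _ _ A_ge0 (k * (l ^+ 2 / b))) => h.
apply: (le_trans (re_le_sq_bounded _ k0 bA)).
rewrite -[leRHS]mulrA ler_pM2l// mulrAC ler_pdivlMr//.
apply: (le_trans (ler_wpM2r (ltW b0) (bPY _))).
by rewrite -[leLHS]mulrA ler_pM2l ?exprn_gt0// mulrC; exact: coerc.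
Qed.

Context (T : H -> H) (T_MA : A_bounded dot M A T) (l : R[i]).
Let X : H -> H := l \*: idfun \- T.
Let Y : H -> H := l \*: P \- (P \o T).

Let PX h : P (X h) = Y h.
Proof. by rewrite /X /Y /= (linear_funB linP) (linear_funZ linP). Qed.

Let YP h : Y (P h) = Y h.
Proof. by rewrite /Y /= PP A_bounded_range_projection. Qed.

Lemma left_A_inverse_compress S : A_bounded dot M A S ->
  A \o S \o X = A -> (P \o S \o P) \o Y = P.
Proof.
move=> SMA /funeqP SX; apply/funext => h /=.
rewrite -PX PP A_bounded_range_projection//.
exact/range_projection_eq/SX.
Qed.

Lemma right_A_inverse_compress S : A \o X \o S = A -> Y \o (P \o S \o P) = P.
Proof.
move=> /funeqP XS; apply/funext => h /=.
rewrite YP -PX -[RHS]PP.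
exact/range_projection_eq/XS.
Qed.

Lemma left_corner_inverse_A S : corner P M S -> S \o Y = P -> A \o S \o X = A.
Proof.
move=> [S' _ <-] /funeqP SY; apply/funext => h /=.
by rewrite -[RHS]AP -(SY h) /= -PX PP.
Qed.

Lemma right_corner_inverse_A S : Y \o S = P -> A \o X \o S = A.
Proof.
move=> /funeqP YS; apply/funext => h /=.
by rewrite -AP PX -[RHS]AP -(YS h).
Qed.

Lemma mem_corner_compress S : A_bounded dot M A S -> corner P M (P \o S \o P).
Proof. by move=> [MS _]; exists S. Qed.

Lemma left_A_invertible_corner :
  left_A_invertible dot M A X <-> left_invertible (corner P M) P Y.
Proof.
split=> -[S]; [move=> SMA SX; exists (P \o S \o P)|move=> cS SY; exists S].
- exact: mem_corner_compress.
- exact: left_A_inverse_compress.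
- exact: corner_A_bounded.
- exact: left_corner_inverse_A.
Qed.

Lemma right_A_invertible_corner :
  right_A_invertible dot M A X <-> right_invertible (corner P M) P Y.
Proof.
split=> -[S]; [move=> SMA XS; exists (P \o S \o P)|move=> cS YS; exists S].
- exact: mem_corner_compress.
- exact: right_A_inverse_compress.
- exact: corner_A_bounded.
- exact: right_corner_inverse_A.
Qed.

Lemma A_invertible_corner :
  A_invertible dot M A X <-> invertible (corner P M) P Y.
Proof.
split=> -[S].
  move=> SMA [XS SX]; exists (P \o S \o P); first exact: mem_corner_compress.
  split; [exact: left_A_inverse_compress|exact: right_A_inverse_compress].
move=> cS [SY YS]; exists S; first exact: corner_A_bounded.
split; [exact: right_corner_inverse_A|exact: left_corner_inverse_A].
Qed.

End ReductionToCorner.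

Theorem theorem2p10 (R : realType) (H : completeNormedModType R[i])
    (dot : {dot H for Num.conj}) (dotH : hilbert_dot dot)
    (M : set (H -> H)) (vnM : von_neumann_algebra dot M)
    (A : H -> H) (MA : M A) (A_neq0 : A <> (fun=> 0))
    (A_ge0 : positive_op dot A)
    (P : H -> H) (projP : range_projection dot A P)
    (A_ws : well_supported M A)
    (T : H -> H) (T_MA : A_bounded dot M A T) :
  [/\ left_A_spectrum dot M A T = left_spectrum (corner P M) P (P \o T),
      right_A_spectrum dot M A T = right_spectrum (corner P M) P (P \o T) &
      A_spectrum dot M A T = spectrum (corner P M) P (P \o T)].
Proof.
split; apply/funext => l; apply/propext; apply: not_iff_compat.
- exact: left_A_invertible_corner.
- exact: right_A_invertible_corner.
- exact: A_invertible_corner.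
Qed.
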